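(* Let $(G,\mathcal{G})$ be a measurable space, let $\mathcal{Q}$ be a defective adapted cocycle, and let $\mathcal{B}$ be a convex subset of the set $\mathcal{P}(\mathcal{G})$ of probability measures on $(G,\mathcal{G})$. Assume that $\mathcal{Q}$ satisfies the finite first-moment assumption and the first-moment deviation inequality uniformly in $\mathcal{B}$. Then the function $\mu\mapsto\ell(\mu;\mathcal{Q})$ is Lipschitz continuous on $\mathcal{B}$, i.e. there is a constant $C$ such that $|\ell(\mu_1;\mathcal{Q})-\ell(\mu_0;\mathcal{Q})|\le C\,\mathbf{n}(\mu_0,\mu_1)$ for all $\mu_0,\mu_1\in\mathcal{B}$.
   Context: $\Omega=G^{\mathbb{N}^*}$, $\mathbb{N}^*=\{1,2,\dots\}$, with product $\sigma$-field; for a probability measure $\mu$ on $G$, $\mathbb{P}^\mu=\mu^{\otimes\mathbb{N}^*}$ with expectation $\mathbb{E}^\mu$. $X_n:\Omega\to G$ are the coordinate maps, $\mathcal{F}_n=\sigma(X_1,\dots,X_n)$, $\theta_n(\omega_1,\omega_2,\dots)=(\omega_{n+1},\omega_{n+2},\dots)$. A defective adapted cocycle is a sequence $\mathcal{Q}=(Q_n)_{n\in\mathbb{N}^*}$ of real-valued maps on $\Omega$ with $Q_n$ measurable with respect to $\mathcal{F}_n$; $Q_0=0$. Its defect is $\Psi_{n,m}(\omega)=Q_{n+m}(\omega)-Q_n(\omega)-Q_m(\theta_n\omega)$. Uniform finite first moment on $\mathcal{B}$: $\sup_{\mu\in\mathcal{B}}\mathbb{E}^\mu[|Q_1|]<\infty$.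 Uniform first-moment deviation inequality on $\mathcal{B}$: $\sup_{\mu\in\mathcal{B}}\sup_{n,m\in\mathbb{N}}\mathbb{E}^\mu[|\Psi_{n,m}|]<\infty$. Under these assumptions the rate of escape $\ell(\mu;\mathcal{Q}):=\lim_n\frac1n\mathbb{E}^\mu[Q_n]$ exists for every $\mu\in\mathcal{B}$. For $\mu,\tilde\mu\in\mathcal{P}(\mathcal{G})$: if they are mutually absolutely continuous with $f=d\tilde\mu/d\mu$, then $\mathbf{n}(\tilde\mu,\mu)=\max\big(\operatorname{ess\,sup}_\mu|f-1|,\ \operatorname{ess\,sup}_\mu|\tfrac1f-1|\big)$; otherwise $\mathbf{n}(\tilde\mu,\mu)=\infty$. *)

(* Defs.v *)
From HB Require Import structures.
From mathcomp Require Import all_boot all_order all_algebra.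
From mathcomp Require Import all_classical all_reals all_analysis.
From mathcomp Require Import measurable_realfun ess_sup_inf.
Set Implicit Arguments.
Unset Strict Implicit.
Unset Printing Implicit Defensive.
Import Order.TTheory GRing.Theory Num.Theory.
Import numFieldNormedType.Exports.
Local Open Scope classical_set_scope.
Local Open Scope ring_scope.
Local Open Scope ereal_scope.

(* Coordinates are numbered from 0: [path_coord i] is the map X_{i+1}. *)
Definition path_space d (G : measurableType d) : Type := nat -> G.

Definition path_display : measure_display -> measure_display.
Proof. exact. Qed.

Section path_space_measurable.
Context d (G : measurableType d).
Local Notation Omega := (path_space G).

Definition path_coord (i : nat) (w : Omega) : G := w i.

Definition path_measurable : set (set Omega) :=
  <<s \bigcup_i preimage_set_system setT (path_coord i) measurable >>.

Let path_measurable0 : path_measurable set0.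
Proof. exact: sigma_algebra0. Qed.

Let path_measurableC A : path_measurable A -> path_measurable (~` A).
Proof. exact: sigma_algebraC. Qed.

Let path_measurable_bigcup (F : (set Omega)^nat) :
  (forall i, path_measurable (F i)) -> path_measurable (\bigcup_i F i).
Proof. exact: sigma_algebra_bigcup. Qed.

HB.instance Definition _ := Pointed.copy Omega (nat -> G).
HB.instance Definition _ := @isMeasurable.Build (path_display d) Omega
  path_measurable path_measurable0 path_measurableC path_measurable_bigcup.

Definition path_shift (n : nat) (w : Omega) : Omega := fun i => w (n + i)%N.

Lemma measurable_path_coord i : measurable_fun setT (path_coord i).
Proof.
move=> _ A mA; rewrite setTI; apply: sub_sigma_algebra.
by exists i => //; exists A => //; rewrite setTI.
Qed.

Lemma measurable_fun_path d' (T : measurableType d') (f : T -> Omega) :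
  (forall i, measurable_fun setT (path_coord i \o f)) -> measurable_fun setT f.
Proof.
move=> mf.
apply: (measurability
  (\bigcup_i preimage_set_system setT (path_coord i) measurable)) => // _ [_ [i _ [A mA <-]] <-].
by rewrite setTI -comp_preimage; exact: mf.
Qed.

End path_space_measurable.

(* The infinite product of mu with itself is the extension of the content [p]
   on cylinders, whose sigma-subadditivity is Ionescu-Tulcea's argument. *)
Section iid_existence.
Context d (G : measurableType d) (R : realType) (mu : probability G R).
Local Notation Omega := (path_space G).

Let scons (x : G) (w : Omega) : Omega := fun n => if n is m.+1 then w m else x.
Let sconsp (p : G * Omega) : Omega := scons p.1 p.2.

Let measurable_sconsp : measurable_fun setT sconsp.
Proof.
apply: measurable_fun_path => -[|i]; first exact: measurable_fst.
have -> : path_coord i.+1 \o sconsp = path_coord i \o snd by [].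
by apply: measurableT_comp => //; exact: measurable_path_coord.
Qed.

HB.instance Definition _ :=
  isMeasurableFun.Build _ _ _ _ sconsp measurable_sconsp.

Let measurable_scons x (A : set Omega) : measurable A ->
  measurable (scons x @^-1` A).
Proof.
move=> mA; rewrite (_ : _ @^-1` _ = xsection (sconsp @^-1` A) x).
  by apply: measurable_xsection; rewrite -[X in measurable X]setTI;
     exact: measurable_sconsp.
by apply/seteqP; split => w /=; rewrite xsectionE/= ?inE.
Qed.

Let pairing (P : probability Omega R) : set (G * Omega) -> \bar R := mu \x P.

HB.instance Definition _ (P : probability Omega R) := Measure.on (pairing P).

Let pairingT (P : probability Omega R) : pairing P setT = 1.
Proof.
transitivity (mu setT * P setT); last by rewrite !probability_setT mule1.
by rewrite /pairing -setXTT [LHS]product_measure1E.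
Qed.

HB.instance Definition _ (P : probability Omega R) :=
  Measure_isProbability.Build _ _ _ (pairing P) (pairingT P).

Let mstep (P : probability Omega R) : probability Omega R :=
  distribution (pairing P) sconsp.

Let mstepE P A : mstep P A = \int[mu]_x P (scons x @^-1` A).
Proof.
rewrite /mstep/= /distribution /pushforward /pairing /product_measure1.
apply: eq_integral => x _ /=.
by congr (P _); apply/seteqP; split => w /=; rewrite xsectionE/= ?inE.
Qed.

(* Coordinates 0, ..., n.-1 independent with law mu, the others constant. *)
Let prefix n : probability Omega R :=
  iter n mstep (dirac point : probability Omega R).

Let prefixS n A : prefix n.+1 A = \int[mu]_x prefix n (scons x @^-1` A).
Proof. exact: mstepE. Qed.

Let mprefix n A : measurable A ->
  measurable_fun [set: G] (fun x => prefix n (scons x @^-1` A)).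
Proof.
move=> mA.
rewrite (_ : (fun _ => _) = prefix n \o xsection (sconsp @^-1` A)).
  apply: measurable_fun_xsection; rewrite -[X in measurable X]setTI.
  exact: measurable_sconsp.
apply/funext => x /=; congr (prefix n _).
by apply/seteqP; split => w /=; rewrite xsectionE/= ?inE.
Qed.

Let det n (A : set Omega) :=
  forall w w', (forall i, (i < n)%N -> w i = w' i) -> A w -> A w'.

Let detW m n A : (m <= n)%N -> det m A -> det n A.
Proof.
by move=> mn dA w w' ww' ; apply: dA => i im; apply: ww'; exact: leq_trans mn.
Qed.

Let detC n A : det n A -> det n (~` A).
Proof.
by move=> dA w w' ww' nAw Aw'; apply: nAw; apply: dA Aw' => i /ww'.
Qed.

Let detU n A B : det n A -> det n B -> det n (A `|` B).
Proof.
by move=> dA dB w w' ww' [Aw|Bw]; [left; exact: dA Aw|right; exact: dB Bw].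
Qed.

Let det_scons n x A : det n.+1 A -> det n (scons x @^-1` A).
Proof.
by move=> dA w w' ww' /=; apply: dA => -[//|i]; rewrite ltnS => /ww'.
Qed.

Let prefix_det n k A : det n A -> prefix (n + k) A = prefix n A.
Proof.
elim: n A => [|n IH] A dA.
  have [->|/set0P[w Aw]] := eqVneq A set0; first by rewrite !measure0.
  suff -> : A = setT by rewrite !probability_setT.
  by apply/seteqP; split => // w' _; exact: dA Aw.
rewrite addSn !prefixS; apply: eq_integral => x _.
by rewrite IH//; exact: det_scons.
Qed.

Let cyl (A : set Omega) := measurable A /\ exists n, det n A.

Let cylT : Type := Omega.
HB.instance Definition _ := Pointed.on cylT.

Let cyl0 : cyl set0. Proof. by split => //; exists 0%N. Qed.

Let cylC : setC_closed cyl.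
Proof.
move=> A [mA [n dA]]; split; first exact: measurableC.
by exists n; exact: detC.
Qed.

Let cylU : setU_closed cyl.
Proof.
move=> A B [mA [n dA]] [mB [m dB]]; split; first exact: measurableU.
by exists (maxn n m); apply: detU;
  [apply: detW dA; exact: leq_maxl|apply: detW dB; exact: leq_maxr].
Qed.

HB.instance Definition _ := @isAlgebraOfSets.Build (path_display d) cylT
  cyl cyl0 cylU cylC.

(* The absolute value only makes p nonnegative off the cylinders. *)
Let p (A : set cylT) : \bar R := `| limn (fun n => prefix n A) |.

Let pE n A : det n A -> p A = prefix n A.
Proof.
move=> dA; rewrite -[RHS]gee0_abs//; congr `| _ |.
apply: cvg_lim => //; apply: cvg_near_cst.
by exists n => // m /= /subnKC <-; rewrite prefix_det.
Qed.

Let p_ge0 A : 0 <= p A.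
Proof. exact: abse_ge0. Qed.

Let det_bound (F : nat -> set Omega) n : (forall k, cyl (F k)) ->
  exists N, forall i, (i < n)%N -> det N (F i).
Proof.
move=> cF; elim: n => [|n [N dN]]; first by exists 0%N.
have [_ [m dm]] := cF n; exists (maxn N m) => i; rewrite ltnS leq_eqVlt.
move=> /predU1P[->|/dN]; first by apply: detW dm; exact: leq_maxr.
by apply: detW; exact: leq_maxl.
Qed.

Let det_bigU (F : nat -> set Omega) n N :
  (forall i, (i < n)%N -> det N (F i)) ->
  det N (\big[setU/set0]_(i < n) F i).
Proof.
move=> dF; rewrite -bigcup_mkord => w w' ww' [i /= ni Fiw].
by exists i => //; exact: dF Fiw.
Qed.

Let p_semi_additive : @measure_function.semi_additive _ R cylT p.
Proof.
move=> F n cF tF _; have [N dN] := det_bound n cF.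
rewrite (pE (det_bigU dN)) measure_semi_additive//.
- by apply: eq_bigr => i _; rewrite (pE (dN _ (ltn_ord i))).
- by move=> k; have [] := cF k.
- by apply: bigsetU_measurable => i _; have [] := cF i.
Qed.

HB.instance Definition _ := isContent.Build _ cylT R p p_ge0 p_semi_additive.

Let big (D : nat -> set Omega) := [/\ forall k, cyl (D k),
  nonincreasing_seq D & exists2 e : R, (0 < e)%R & forall k, e%:E <= p (D k)].

Let cyl_scons x A : cyl A -> cyl (scons x @^-1` A).
Proof.
move=> [mA [n dA]]; split; first exact: measurable_scons.
by exists n; apply: det_scons; exact: detW dA.
Qed.

Let p_scons A : cyl A -> p A = \int[mu]_x p (scons x @^-1` A).
Proof.
move=> [mA [n dA]]; rewrite (pE (detW (leqnSn n) dA)) prefixS.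
apply: eq_integral => x _; rewrite (@pE n)//.
by apply: det_scons; exact: detW dA.
Qed.

Let measurable_p A : cyl A ->
  measurable_fun [set: G] (fun x => p (scons x @^-1` A)).
Proof.
move=> [mA [n dA]]; rewrite (_ : (fun _ => _) =
  (fun x => prefix n (scons x @^-1` A) : \bar R)); first exact: mprefix.
by apply/funext => x; rewrite (@pE n)//; apply: det_scons; exact: detW dA.
Qed.

Let p_le A B : cyl A -> cyl B -> A `<=` B -> p A <= p B.
Proof. by move=> cA cB AB; apply: le_measure; rewrite ?inE. Qed.

Let p_le1 A : cyl A -> p A <= 1.
Proof. by move=> [mA [n dA]]; rewrite (pE dA) probability_le1. Qed.

Let big_step D : big D -> exists x, big (fun k => scons x @^-1` D k).
Proof.
move=> [cD niD [e e0 De]].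
pose E k := [set x | (e / 2)%:E <= p (scons x @^-1` D k)].
have mE k : measurable (E k).
  rewrite -[E k]setTI; apply: measurable_lee => //; exact: measurable_p.
have niE : nonincreasing_seq E.
  move=> m n mn; apply/subsetPset => x /= /le_trans; apply.
  apply: p_le; [exact: cyl_scons|exact: cyl_scons|].
  by apply: preimage_subset; exact/subsetPset/niD.
have muE k : (e / 2)%:E <= mu (E k).
  have : p (D k) <= mu (E k) + (e / 2)%:E.
    rewrite p_scons//.
    apply: (@le_trans _ _ (\int[mu]_x ((\1_(E k) x)%:E + (e / 2)%:E))).
      apply: ge0_le_integral => //.
      - exact: measurable_p.
      - apply: emeasurable_funD => //; apply/measurable_EFinP.
        exact: measurable_indic.
      - move=> x _; have [xE|xE] := pselect (E k x).
          rewrite indicE mem_set//= (le_trans (p_le1 (cyl_scons x (cD k))))//.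
          by rewrite leeDl// lee_fin ltW// divr_gt0.
        rewrite indicE memNset//= add0e ltW// ltNge; exact/negP.
    rewrite ge0_integralD//=.
    + rewrite integral_indic// setIT integral_cst//.
      rewrite [X in _ * X]probability_setT.
      by rewrite mule1.
    + by apply/measurable_EFinP; exact: measurable_indic.
    + by move=> x _; rewrite lee_fin ltW// divr_gt0.
  move=> /(le_trans (De k)).
  rewrite -leeBlDr// -EFinB; apply: le_trans.
  by rewrite lee_fin {2}(splitr e) addrK.
have : (e / 2)%:E <= mu (\bigcap_k E k).
  have /cvg_lim <- // := @nonincreasing_cvg_mu _ _ _ mu E (le_lt_trans
    (probability_le1 _ (mE 0%N)) (ltry _)) mE (bigcapT_measurable mE) niE.
  apply: lime_ge; last exact: nearW.
  apply: ereal_nonincreasing_is_cvgn => m n mn.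
  by apply: le_measure; rewrite ?inE//; exact/subsetPset/niE.
have [->|/set0P[x Ex] _] := eqVneq (\bigcap_k E k) set0.
  by rewrite measure0 leNgt lte_fin divr_gt0.
exists x; split.
- by move=> k; exact: cyl_scons.
- move=> m n mn; apply/subsetPset; apply: preimage_subset.
  exact/subsetPset/niD.
- by exists (e / 2)%R; [rewrite divr_gt0|move=> k; exact: (Ex k)].
Qed.

Let big_nonempty D k : big D -> D k !=set0.
Proof.
move=> [cD _ [e e0 De]]; apply/set0P/eqP => Dk0.
by have := De k; rewrite Dk0 (@pE 0%N)// measure0 leNgt lte_fin e0.
Qed.

Let big_bigcap D : big D -> exists w, forall k, D k w.
Proof.
move=> bD.
pose T := {D : nat -> set Omega | big D}.
have /choice[f fP] : forall D : T, exists x : G,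
    big (fun k => scons x @^-1` (sval D) k).
  by move=> [D' bD']; exact: big_step.
pose next (D : T) : T := exist _ _ (fP D).
pose s m : T := iter m next (exist _ D bD).
pose w : Omega := fun m => f (s m).
pose pre m (v : Omega) : Omega :=
  fun i => if (i < m)%N then w i else v (i - m)%N.
have sE m k v : sval (s m) k v -> D k (pre m v).
  elim: m v => [|m IH] v.
    rewrite (_ : pre 0%N v = v)//; apply/funext => i.
    by rewrite /pre ltn0 subn0.
  rewrite /= => /IH; congr (D k _); apply/funext => i.
  rewrite /pre ltnS [in RHS]leq_eqVlt.
  case: ltngtP => //= [mi|->]; last by rewrite subnn.
  by rewrite -subnSK.
exists w => k; have [cD _ _] := bD; have [_ [n dn]] := cD k.
have [v sv] := big_nonempty k (svalP (s n)).
by apply: dn (sE _ _ _ sv) => i ni; rewrite /pre ni.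
Qed.

Let p_sigma_subadditive : @measurable_subset_sigma_subadditive _ R cylT p.
Proof.
move=> A F cF cA AF; rewrite leNgt; apply/negP => pAF.
have pAfin : p A \is a fin_num.
  by rewrite ge0_fin_numE// (le_lt_trans (p_le1 cA))// ltry.
have pFfin : \sum_(n <oo) p (F n) \is a fin_num.
  rewrite ge0_fin_numE; last exact: nneseries_ge0.
  by rewrite (lt_le_trans pAF)// leey.
pose e := (fine (p A) - fine (\sum_(n <oo) p (F n)))%R.
have e0 : (0 < e)%R by rewrite subr_gt0 fine_lt.
pose D k := A `\` \big[setU/set0]_(i < k) F i.
have cU k : cyl (\big[setU/set0]_(i < k) F i).
  elim: k => [|k IH]; first by rewrite big_ord0; exact: cyl0.
  by rewrite big_ord_recr/=; apply: cylU; [exact: IH|exact: cF].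
have cDk k : cyl (D k).
  by rewrite /D setDE; apply: (@measurableI _ cylT); [exact: cA|exact: cylC].
have [|w wD] := @big_bigcap D; last first.
  have /AF[k _ Fkw] := (wD 0%N).1.
  by apply: (wD k.+1).2; rewrite -bigcup_mkord; exists k => //=.
split => //.
  move=> m n mn; apply/subsetPset; apply: setDS.
  rewrite -!bigcup_mkord => w [i /= im Fi]; exists i => //=.
  exact: leq_trans mn.
exists e => // k; rewrite EFinB !fineK// leeBlDr//.
pose F' i := if i is j.+1 then F j else D k.
have : p A <= \sum_(i < k.+1) p (F' i).
  apply: (@content_subadditive _ _ cylT p) => //.
    by move=> [|i] _; [exact: cDk|exact: cF].
  rewrite -bigcup_mkord => w Aw.
  have [Uw|nUw] := pselect ((\big[setU/set0]_(i < k) F i) w); last first.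
    by exists 0%N.
  by move: Uw; rewrite -bigcup_mkord => -[i /= ik Fiw]; exists i.+1.
rewrite big_ord_recl/= => /le_trans; apply.
rewrite leeD2l// (@le_trans _ _ (\sum_(0 <= i < k) p (F i)))//.
  by rewrite big_mkord.
by apply: nneseries_lim_ge => i _ _.
Qed.

HB.instance Definition _ :=
  Content_SigmaSubAdditive_isMeasure.Build _ R cylT p p_sigma_subadditive.

Let sigma_cyl := g_sigma_algebraType (@measurable _ cylT).
Let of_sigma_cyl (w : sigma_cyl) : Omega := w.

Let measurable_of_sigma_cyl : measurable_fun setT of_sigma_cyl.
Proof.
apply: measurable_fun_path => i _ A mA; rewrite setTI.
apply: sub_sigma_algebra; split.
  by rewrite -[X in measurable X]setTI; exact: measurable_path_coord.
exists i.+1 => w w' ww' Aw; suff : A (w' i) by [].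
  by rewrite -ww'.
Qed.

HB.instance Definition _ :=
  isMeasurableFun.Build _ _ _ _ of_sigma_cyl measurable_of_sigma_cyl.

Let ext : set sigma_cyl -> \bar R := measure_extension p.
HB.instance Definition _ := Measure.on ext.

Let extE A : cyl A -> ext A = p A.
Proof. by move=> cA; exact: measurable_mu_extE. Qed.

Let extT : ext setT = 1.
Proof.
have dT : det 0 setT by [].
by rewrite extE; [rewrite (pE dT) probability_setT|split => //; exists 0%N].
Qed.

HB.instance Definition _ := Measure_isProbability.Build _ _ _ ext extT.

Let box n (A : nat -> set G) : set Omega :=
  [set w | forall i, (i < n)%N -> A i (path_coord i w)].

Let measurable_box n A : (forall i, measurable (A i)) -> measurable (box n A).
Proof.
move=> mA; rewrite (_ : box n A = \bigcap_(i in `I_n) (path_coord i @^-1` A i)).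
  apply: bigcap_measurableType => i _.
  by rewrite -[X in measurable X]setTI; exact: measurable_path_coord.
by apply/seteqP; split => w Aw i; exact: Aw.
Qed.

Let prefix_box n A : (forall i, measurable (A i)) ->
  prefix n (box n A) = \prod_(i < n) mu (A i).
Proof.
elim: n A => [|n IH] A mA.
  rewrite big_ord0 (_ : box 0 A = setT) ?probability_setT//.
  by apply/seteqP; split.
rewrite prefixS big_ord_recl/= -(IH (A \o S)); last first.
  by move=> i; exact: mA.
rewrite -[in RHS](setIT (A 0%N)) -integral_indic//.
rewrite -ge0_integralZr//=; last first.
  by apply/measurable_EFinP; exact: measurable_indic.
apply: eq_integral => x _; have [xA|xA] := pselect (A 0%N x).
  rewrite indicE mem_set// mul1e; congr (prefix n _).
  apply/seteqP; split => [w Aw i ni|w Aw [|i] ni]//=.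
    exact: (Aw i.+1).
  exact: Aw.
rewrite indicE memNset// mul0e (_ : _ @^-1` _ = set0) ?measure0//.
by apply/seteqP; split => // w /(_ 0%N isT).
Qed.

Definition is_iid_law (P : probability Omega R) :=
  forall n (A : nat -> set G), (forall i, measurable (A i)) ->
    P [set w | forall i, (i < n)%N -> A i (path_coord i w)] =
    \prod_(i < n) mu (A i).

Lemma iid_law_exists : exists P : probability Omega R, is_iid_law P.
Proof.
exists (distribution ext of_sigma_cyl) => n A mA.
have db : det n (box n A).
  by move=> w w' ww' Aw i ni; rewrite /path_coord -ww'//; exact: Aw.
rewrite /distribution/= /pushforward.
transitivity (ext (box n A)); first by [].
rewrite extE; last by split; [exact: measurable_box|exists n].
by rewrite (pE db); exact: prefix_box.
Qed.

Definition iid_law : probability Omega R := sval (cid iid_law_exists).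

Lemma iid_lawP : is_iid_law iid_law.
Proof. exact: svalP. Qed.

End iid_existence.

Section cocycle.
Context d (G : measurableType d) (R : realType).
Local Notation Omega := (path_space G).

(* sigma(X_1, ..., X_n) *)
Definition filtration (n : nat) : set (set Omega) :=
  g_sigma_preimage (fun i : 'I_n => path_coord i : Omega -> G).

Definition defective_adapted_cocycle (Q : nat -> Omega -> R) :=
  Q 0%N = cst 0%R /\
  forall n, (0 < n)%N ->
    preimage_set_system setT (Q n) measurable `<=` filtration n.

Definition defect (Q : nat -> Omega -> R) (n m : nat) (w : Omega) : R :=
  (Q (n + m)%N w - Q n w - Q m (path_shift n w))%R.

Definition uniform_first_moment (Q : nat -> Omega -> R)
    (B : set (probability G R)) :=
  ereal_sup [set 'E_(iid_law mu)[fun w => `|Q 1%N w|%R] | mu in B] < +oo.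

Definition uniform_deviation_inequality (Q : nat -> Omega -> R)
    (B : set (probability G R)) :=
  ereal_sup [set ereal_sup (range (fun nm : nat * nat =>
      'E_(iid_law mu)[fun w => `|defect Q nm.1 nm.2 w|%R])) | mu in B] < +oo.

Definition rate_of_escape (Q : nat -> Omega -> R) (mu : probability G R)
    : \bar R :=
  limn (fun n => n%:R^-1%:E * 'E_(iid_law mu)[Q n]).

(* Elements of [probability G R] agreeing on all measurable sets are the same
   probability measure, although they may differ as functions on all sets;
   hence the convex combination is only required up to this identification. *)
Definition convex_probabilities (B : set (probability G R)) :=
  forall mu nu (t : R), B mu -> B nu -> (0 <= t <= 1)%R ->
    exists2 rho, B rho &
      forall A, measurable A ->
        rho A = t%:E * mu A + (1 - t)%:E * nu A.

Definition mutually_absolutely_continuous (mu nu : probability G R) :=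
  mu `<< nu /\ nu `<< mu.

Definition density_distance (tmu mu : probability G R) : \bar R :=
  let f := Radon_Nikodym (charge_of_finite_measure tmu) mu in
  if `[< mutually_absolutely_continuous tmu mu >] then
    maxe (ess_sup mu (fun x => `|f x - 1|))
         (ess_sup mu (fun x => `|(f x)^-1 - 1|))
  else +oo.

End cocycle.

(* Main.v *)
Require Import Defs.
From HB Require Import structures.
From mathcomp Require Import all_boot all_order all_algebra.
From mathcomp Require Import all_classical all_reals all_analysis.
From mathcomp Require Import measurable_realfun ess_sup_inf.
From mathcomp Require Import ring lra.

Set Implicit Arguments.
Unset Strict Implicit.
Unset Printing Implicit Defensive.
Import Order.TTheory GRing.Theory Num.Theory.
Import numFieldNormedType.Exports.
Local Open Scope classical_set_scope.
Local Open Scope ring_scope.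
Local Open Scope ereal_scope.

(* Write P_k for the law under which the coordinates are independent, the first
   k with law nu and the others with law mu.  If nu lies between (1 - e) mu and
   (1 + e) mu, then P_{k+1} lies between (1 - e) P_k and (1 + e) P_k, and
   P_k <= (1 + e)^k P_0.  In the decomposition
     Q_n = Q_k + Q_{n-k-1} o theta_{k+1} + residual,
   where the residual is made of Q_1 o theta_k and of two defects, the first two
   terms have the same mean under P_k and P_{k+1}: only the residual contributes
   to the difference of the means of Q_n, by at most e times its L^1-norm.
   Hence E^nu Q_n and E^mu Q_n differ by at most n e (M + D + (1 + e)^n D),
   while quasi-additivity gives |E Q_n / n - l| <= D / n.  Taking n about 1/e
   makes both errors O(e). *)

(** * Integrals against two measures that bound each other up to constants *)

Section measure_comparison.
Context d (T : measurableType d) (R : realType).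
Implicit Types (m : {measure set T -> \bar R}) (f : T -> R).

Lemma ge0_le_integral_scaled m1 m2 (a b : R) (f : T -> \bar R) :
  (0 <= a)%R -> (0 <= b)%R ->
  (forall A, measurable A -> a%:E * m1 A <= b%:E * m2 A) ->
  measurable_fun setT f -> (forall x, 0 <= f x) ->
  a%:E * \int[m1]_x f x <= b%:E * \int[m2]_x f x.
Proof.
move=> a0 b0 m12 mf f0.
have := @ge0_le_measure_integral _ _ _ (mscale (NngNum a0) m1)
  (mscale (NngNum b0) m2) m12 f setT measurableT f0 mf.
by rewrite !ge0_integral_mscale.
Qed.

Lemma integrable_scaled m1 m2 (c : R) (f : T -> \bar R) : (0 <= c)%R ->
  (forall A, measurable A -> m1 A <= c%:E * m2 A) ->
  m2.-integrable setT f -> m1.-integrable setT f.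
Proof.
move=> c0 m12 /integrableP[mf foo]; apply/integrableP; split => //.
rewrite -[ltLHS]mul1e; apply: (@le_lt_trans _ _ (c%:E * \int[m2]_x `|f x|)).
  apply: ge0_le_integral_scaled => //; last exact: measurableT_comp.
  by move=> A mA; rewrite mul1e m12.
by rewrite lte_mul_pinfty// lee_fin.
Qed.

Lemma le_Rintegral_scaled m1 m2 (a b : R) f : (0 <= a)%R -> (0 <= b)%R ->
  (forall A, measurable A -> a%:E * m1 A <= b%:E * m2 A) ->
  m1.-integrable setT (EFin \o f) -> m2.-integrable setT (EFin \o f) ->
  (forall x, 0 <= f x)%R ->
  (a * \int[m1]_x f x <= b * \int[m2]_x f x)%R.
Proof.
move=> a0 b0 m12 if1 if2 f0; rewrite -lee_fin !EFinM !fineK.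
- apply: ge0_le_integral_scaled => //; first exact: measurable_int if1.
- exact: integrable_fin_num.
- exact: integrable_fin_num.
Qed.

(** The error is relative to the L^1-norm of f, so terms with equal means should be removed from f
    beforehand. *)
Lemma Rintegral_close m1 m2 (e : R) f : (0 <= e <= 1)%R ->
  (forall A, measurable A -> (1 - e)%:E * m1 A <= m2 A) ->
  (forall A, measurable A -> m2 A <= (1 + e)%:E * m1 A) ->
  m1.-integrable setT (EFin \o f) ->
  (`|\int[m2]_x f x - \int[m1]_x f x| <= e * \int[m1]_x `|f x|)%R.
Proof.
move=> /andP[e0 e1] lo hi if1.
have if2 : m2.-integrable setT (EFin \o f).
  by apply: integrable_scaled hi if1; rewrite addr_ge0.
have ig1 : m1.-integrable setT (EFin \o (fun x => `|f x|)%R).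
  exact: integrable_norm.
have ig2 : m2.-integrable setT (EFin \o (fun x => `|f x|)%R).
  exact: integrable_norm.
have close (g : T -> R) : m1.-integrable setT (EFin \o g) ->
    m2.-integrable setT (EFin \o g) -> (forall x, 0 <= g x)%R ->
    (`|\int[m2]_x g x - \int[m1]_x g x| <= e * \int[m1]_x g x)%R.
  move=> i1 i2 g0.
  have H1 : ((1 - e) * \int[m1]_x g x <= 1 * \int[m2]_x g x)%R.
    apply: le_Rintegral_scaled => //; first by rewrite subr_ge0.
    by move=> A mA; rewrite mul1e lo.
  have H2 : (1 * \int[m2]_x g x <= (1 + e) * \int[m1]_x g x)%R.
    apply: le_Rintegral_scaled => //; first by rewrite addr_ge0.
    by move=> A mA; rewrite mul1e hi.
  by rewrite ler_norml; apply/andP; split; lra.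
(* Using |f| + f and |f| - f, with half-difference f and half-sum |f|, keeps
   the constant e. *)
have sum1 : m1.-integrable setT (EFin \o (fun x => `|f x| + f x)%R).
  by apply: (integrableD measurableT ig1 if1).
have sum2 : m2.-integrable setT (EFin \o (fun x => `|f x| + f x)%R).
  by apply: (integrableD measurableT ig2 if2).
have dif1 : m1.-integrable setT (EFin \o (fun x => `|f x| - f x)%R).
  by apply: (integrableB measurableT ig1 if1).
have dif2 : m2.-integrable setT (EFin \o (fun x => `|f x| - f x)%R).
  by apply: (integrableB measurableT ig2 if2).
have := close _ dif1 dif2; rewrite !RintegralB// => HB.
have := close _ sum1 sum2; rewrite !RintegralD// => HD.
have {}HB := HB (fun x => etrans (subr_ge0 _ _) (ler_norm _)).
have {}HD : (`|\int[m2]_x `|f x| + \int[m2]_x f x -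
    (\int[m1]_x `|f x| + \int[m1]_x f x)| <=
    e * (\int[m1]_x `|f x| + \int[m1]_x f x))%R.
  apply: HD => x; rewrite -[f x in X in (_ + X)%R]opprK subr_ge0 -normrN.
  exact: ler_norm.
move: HB HD; rewrite !ler_norml => /andP[? ?] /andP[? ?].
by apply/andP; split; lra.
Qed.

End measure_comparison.

(** * Prepending a coordinate, the shift, and sets determined by a prefix *)

Section path_cons.
Context d (G : measurableType d).
Local Notation Omega := (path_space G).

Definition path_cons (x : G) (w : Omega) : Omega :=
  fun n => if n is m.+1 then w m else x.

(** The path comes first because [\x^] has the outer integral over its second factor, here the new
    coordinate. *)
Definition path_cons_pair (p : Omega * G) : Omega := path_cons p.2 p.1.

Lemma measurable_path_cons_pair : measurable_fun setT path_cons_pair.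
Proof.
apply: measurable_fun_path => -[|i]; first exact: measurable_snd.
have -> : path_coord i.+1 \o path_cons_pair = path_coord i \o fst by [].
by apply: measurableT_comp => //; exact: measurable_path_coord.
Qed.

HB.instance Definition _ :=
  isMeasurableFun.Build _ _ _ _ path_cons_pair measurable_path_cons_pair.

Lemma ysection_path_cons x (A : set Omega) :
  ysection (path_cons_pair @^-1` A) x = path_cons x @^-1` A.
Proof. by apply/seteqP; split => w /=; rewrite ysectionE/= ?inE. Qed.

Lemma measurable_path_cons_preimage x (A : set Omega) : measurable A ->
  measurable (path_cons x @^-1` A).
Proof.
move=> mA; rewrite -ysection_path_cons; apply: measurable_ysection.
by rewrite -[X in measurable X]setTI; exact: measurable_path_cons_pair.
Qed.

Lemma measurable_path_shift n : measurable_fun setT (@path_shift d G n).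
Proof.
apply: measurable_fun_path => i.
have -> : path_coord i \o path_shift n = @path_coord d G (n + i) by [].
exact: measurable_path_coord.
Qed.

HB.instance Definition _ n :=
  isMeasurableFun.Build _ _ _ _ (@path_shift d G n) (measurable_path_shift n).

Definition prefix_determined n (A : set Omega) :=
  forall w w', (forall i, (i < n)%N -> w i = w' i) -> A w -> A w'.

Lemma prefix_determinedW m n A : (m <= n)%N ->
  prefix_determined m A -> prefix_determined n A.
Proof.
by move=> mn dA w w' ww'; apply: dA => i im; apply: ww'; exact: leq_trans mn.
Qed.

(** Sets that depend only on the first n coordinates form a sigma-algebra containing the generators
    of [filtration n]. *)
Lemma filtration_prefix_determined n :
  @filtration d G n `<=` prefix_determined n.
Proof.
apply: smallest_sub => [|A].
  split.
  - by move=> w w'.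
  - move=> A dA w w' ww' [_ nAw]; split => // Aw'; apply: nAw.
    by apply: dA Aw' => i /ww'.
  - by move=> F dF w w' ww' [k _ Fkw]; exists k => //; exact: dF Fkw.
rewrite -bigcup_seq => -[i _ [B mB <-]] w w' ww' [_ /= Bw].
by split => //=; rewrite /path_coord -ww'.
Qed.

Lemma filtration_measurable n : @filtration d G n `<=` measurable.
Proof.
apply: smallest_sub => [|A]; first exact: sigma_algebra_measurable.
rewrite -bigcup_seq => -[i _ [B mB <-]].
exact: measurable_path_coord.
Qed.

End path_cons.

(** * Laws of paths with independent coordinates prepended *)

Section path_step.
Context d (G : measurableType d) (R : realType).
Local Notation Omega := (path_space G).
Implicit Types (mu : probability G R) (P : probability Omega R).

(** Prepends an independent coordinate of law mu; iterating with nu from [iid_law mu] produces the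
    laws P_k. *)
Definition path_step mu P : probability Omega R :=
  distribution (P \x^ mu) (@path_cons_pair d G).

Lemma path_stepE mu P A :
  path_step mu P A = \int[mu]_x P (path_cons x @^-1` A).
Proof.
rewrite /path_step/= /distribution /pushforward /product_measure2/=.
by apply: eq_integral => x _ /=; rewrite ysection_path_cons.
Qed.

Lemma measurable_path_cons_probability P A : measurable A ->
  measurable_fun [set: G] (fun x => P (path_cons x @^-1` A)).
Proof.
move=> mA; rewrite (_ : (fun _ => _) =
    P \o ysection (@path_cons_pair d G @^-1` A)).
  apply: measurable_fun_ysection; rewrite -[X in measurable X]setTI.
  exact: measurable_path_cons_pair.
by apply/funext => x /=; rewrite ysection_path_cons.
Qed.

(** P1 is compared with P2 inside the integral, then mu1 with mu2 outside; the constants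
    multiply. *)
Lemma path_step_scaled mu1 mu2 P1 P2 (a b a' b' : R) :
  (0 <= a)%R -> (0 <= b)%R -> (0 <= a')%R -> (0 <= b')%R ->
  (forall A, measurable A -> a%:E * mu1 A <= b%:E * mu2 A) ->
  (forall A, measurable A -> a'%:E * P1 A <= b'%:E * P2 A) ->
  forall A, measurable A ->
    (a * a')%:E * path_step mu1 P1 A <= (b * b')%:E * path_step mu2 P2 A.
Proof.
move=> a0 b0 a'0 b'0 mu12 P12 A mA; rewrite !path_stepE !EFinM -!muleA.
have mP P := @measurable_path_cons_probability P A mA.
apply: (@le_trans _ _ (a%:E * (b'%:E * \int[mu1]_x P2 (path_cons x @^-1` A)))).
  rewrite lee_wpmul2l ?lee_fin// -!ge0_integralZl//.
  apply: ge0_le_integral => //.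
  - by move=> x _; rewrite mule_ge0.
  - exact: measurable_funeM.
  - exact: measurable_funeM.
  - by move=> x _; apply: P12; exact: measurable_path_cons_preimage.
rewrite (muleCA a%:E) (muleCA b%:E) lee_wpmul2l ?lee_fin//.
exact: ge0_le_integral_scaled.
Qed.

(** Prepending the same law on both sides costs a factor 1, so the constants do not grow with k. *)
Lemma iter_path_step_scaled mu P1 P2 (a b : R) k :
  (0 <= a)%R -> (0 <= b)%R ->
  (forall A, measurable A -> a%:E * P1 A <= b%:E * P2 A) ->
  forall A, measurable A -> a%:E * iter k (path_step mu) P1 A <=
    b%:E * iter k (path_step mu) P2 A.
Proof.
move=> a0 b0 P12; elim: k => //= k IH A mA.
rewrite -[a]mul1r -[b]mul1r.
by apply: path_step_scaled IH _ mA => // B mB; rewrite !mul1e.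
Qed.

(** The shift deletes exactly the prepended coordinates: at each step the integrand is constant in
    x. *)
Lemma iter_path_step_shift mu P k A : measurable A ->
  iter k (path_step mu) P (path_shift k @^-1` A) = P A.
Proof.
move=> mA; elim: k => [|k IH]; first by [].
rewrite iterS path_stepE -[RHS]IH -[RHS]mule1 -(probability_setT mu).
rewrite -integral_cst//; exact: eq_integral.
Qed.

(** The first k coordinates are drawn from mu whatever the starting law; a set determined by no
    coordinate is empty or full. *)
Lemma iter_path_step_prefix mu P1 P2 k A : prefix_determined k A ->
  iter k (path_step mu) P1 A = iter k (path_step mu) P2 A.
Proof.
elim: k A => [|k IH] A dA.
  have [->|/set0P[w Aw]] := eqVneq A set0; first by rewrite !measure0.
  suff -> : A = setT by rewrite !probability_setT.
  by apply/seteqP; split => // w' _; exact: dA Aw.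
rewrite !iterS !path_stepE; apply: eq_integral => x _; apply: IH.
by move=> w w' ww' /=; apply: dA => -[//|i]; rewrite ltnS => /ww'.
Qed.

(** A point x contributes the box of the remaining sides if it lies in [A 0], and nothing otherwise,
    so [mu (A 0)] factors out. *)
Lemma is_iid_law_path_step mu P : is_iid_law mu P ->
  is_iid_law mu (path_step mu P).
Proof.
move=> iidP [|n] A mA.
  rewrite big_ord0 (_ : [set _ | _] = setT) ?probability_setT//.
  by apply/seteqP; split.
rewrite path_stepE big_ord_recl/= -(iidP n (A \o S)); last first.
  by move=> i; exact: mA.
rewrite -[in RHS](setIT (A 0%N)) -integral_indic//.
rewrite -ge0_integralZr//=; last first.
  by apply/measurable_EFinP; exact: measurable_indic.
apply: eq_integral => x _; have [xA|xA] := pselect (A 0%N x).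
  rewrite indicE mem_set// mul1e; congr (P _).
  apply/seteqP; split => [w Aw i ni|w Aw [|i] ni]//=.
    exact: (Aw i.+1).
  exact: Aw.
rewrite indicE memNset// mul0e (_ : _ @^-1` _ = set0) ?measure0//.
by apply/seteqP; split => // w /(_ 0%N isT).
Qed.

(** As [iid_law] is obtained by choice, only its values on boxes are known; boxes form a generating
    pi-system, so these values determine it. *)
Lemma is_iid_law_unique mu P1 P2 : is_iid_law mu P1 -> is_iid_law mu P2 ->
  forall A, measurable A -> P1 A = P2 A.
Proof.
move=> iid1 iid2.
pose box n (A : nat -> set G) : set Omega :=
  [set w | forall i, (i < n)%N -> A i (path_coord i w)].
pose boxes : set (set Omega) :=
  [set B | exists n A, (forall i, measurable (A i)) /\ B = box n A].
have mbox n A : (forall i, measurable (A i)) -> measurable (box n A).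
  move=> mA.
  rewrite (_ : box n A = \bigcap_(i in `I_n) (path_coord i @^-1` A i)).
    apply: bigcap_measurableType => i _.
    by rewrite -[X in measurable X]setTI; exact: measurable_path_coord.
  by apply/seteqP; split => w Aw i; exact: Aw.
apply: (@measure_unique _ _ _ boxes (fun _ => setT)).
- apply/seteqP; split; last first.
    apply: smallest_sub; first exact: sigma_algebra_measurable.
    by move=> _ [n [A [mA ->]]]; exact: mbox.
  apply: smallest_sub; first exact: smallest_sigma_algebra.
  move=> _ [i _ [A mA <-]]; apply: sub_sigma_algebra.
  exists i.+1, (fun j => if j == i then A else setT); split.
    by move=> j; case: ifP.
  apply/seteqP; split => [w [_ Aw] j _|w /(_ i (ltnSn i))].
    by case: eqP => // ->.
  by rewrite eqxx.
- move=> _ _ [n [A [mA ->]]] [m [B [mB ->]]].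
  (* Padding both boxes with full sides up to the greater length makes their intersection a box. *)
  exists (maxn n m), (fun i => (if (i < n)%N then A i else setT) `&`
    (if (i < m)%N then B i else setT)); split.
    by move=> i; apply: measurableI; case: ifP.
  apply/seteqP; split => [w [Aw Bw] i _|w ABw].
    by split; case: ifP => //; [move=> /Aw|move=> /Bw].
  split => i im; have := ABw i; rewrite leq_max im ?orbT => /(_ isT)[].
    by [].
  by [].
- move=> _; exists 0%N, (fun _ => setT); split => //.
  by apply/seteqP; split.
- by rewrite bigcup_const.
- move=> _ [n [A [mA ->]]].
  exact: etrans (iid1 n A mA) (esym (iid2 n A mA)).
- by move=> _; exact: le_lt_trans (probability_le1 _ measurableT) (ltry _).
Qed.

Lemma iter_path_step_iid mu k A : measurable A ->
  iter k (path_step mu) (iid_law mu) A = iid_law mu A.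
Proof.
move=> mA; apply: (@is_iid_law_unique mu) => //; last exact: iid_lawP.
by elim: k => [|k IH]; [exact: iid_lawP|exact: is_iid_law_path_step].
Qed.

End path_step.

(** * Change of variables along a map with given image law *)

Section equality_in_law.
Context d d' (X : measurableType d) (Y : measurableType d') (R : realType).
Variables (P1 : probability X R) (P2 : probability Y R) (phi : {mfun X >-> Y}).
Hypothesis law_phi : forall A, measurable A -> P1 (phi @^-1` A) = P2 A.
Implicit Types f : Y -> R.

Let eq_law A : measurable A -> A `<=` setT -> distribution P1 phi A = P2 A.
Proof. by move=> mA _; exact: law_phi. Qed.

Lemma integrable_eq_law f : P2.-integrable setT (EFin \o f) ->
  P1.-integrable setT (EFin \o (f \o phi)).
Proof.
move=> /integrableP[mf foo]; apply/integrableP; split.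
  exact: measurableT_comp mf _.
rewrite -(@ge0_integral_distribution _ _ _ _ _ P1 phi (fun y => `|(f y)%:E|))//.
  by rewrite (eq_measure_integral P2).
exact: measurableT_comp mf.
Qed.

Lemma Rintegral_eq_law f : P2.-integrable setT (EFin \o f) ->
  (\int[P1]_x f (phi x) = \int[P2]_y f y)%R.
Proof.
move=> intf; congr fine; have intfphi := integrable_eq_law intf.
rewrite -(@eq_measure_integral _ _ _ _ P2 (distribution P1 phi))//.
by rewrite (@integral_distribution _ _ _ _ _ P1 phi (EFin \o f))//;
  exact: measurable_int intf.
Qed.

End equality_in_law.

(** * Means of the cocycle under iid laws and mixed laws *)

Section cocycle_expectation.
Context d (G : measurableType d) (R : realType) (Q : nat -> path_space G -> R).
Local Notation Omega := (path_space G).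
Implicit Types (mu nu : probability G R) (P : probability Omega R).
Hypothesis adaptedQ : defective_adapted_cocycle Q.

Lemma adapted_prefix_determined n A : measurable A ->
  prefix_determined n (Q n @^-1` A).
Proof.
have [Q0 adQ] := adaptedQ; case: n => [|n] mA; first by rewrite Q0.
rewrite -[_ @^-1` _]setTI; apply: filtration_prefix_determined.
by apply: adQ => //; exists A.
Qed.

Lemma adapted_measurable n : measurable_fun setT (Q n).
Proof.
have [Q0 adQ] := adaptedQ; case: n => [|n]; first by rewrite Q0.
move=> _ A mA; apply: (@filtration_measurable _ _ n.+1).
by apply: adQ => //; exists A.
Qed.

Lemma measurable_defect n m : measurable_fun setT (defect Q n m).
Proof.
apply: measurable_funB; first apply: measurable_funB.
- exact: adapted_measurable.
- exact: adapted_measurable.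
- apply: measurableT_comp; first exact: adapted_measurable.
  exact: measurable_path_shift.
Qed.

Lemma defectE n m w :
  (Q (n + m)%N w = Q n w + Q m (path_shift n w) + defect Q n m w)%R.
Proof. by rewrite /defect; ring. Qed.

(** Stationarity: prepending n coordinates of law mu does not change the law, and the shift removes
    them again. *)
Lemma iid_law_shift mu n A : measurable A ->
  iid_law mu (path_shift n @^-1` A) = iid_law mu A.
Proof.
move=> mA; rewrite -[LHS](@iter_path_step_iid _ _ _ _ n).
  exact: iter_path_step_shift.
by rewrite -[X in measurable X]setTI; exact: measurable_path_shift.
Qed.

Definition first_moment_bound mu (M : R) :=
  'E_(iid_law mu)[fun w => `|Q 1%N w|%R] <= M%:E.

Definition deviation_bound mu (D : R) :=
  forall n m, 'E_(iid_law mu)[fun w => `|defect Q n m w|%R] <= D%:E.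

Let integrable_expectation_bound P (X : Omega -> R) (c : R) :
  measurable_fun setT X -> 'E_P[fun w => `|X w|%R] <= c%:E ->
  P.-integrable setT (EFin \o X) /\ (\int[P]_w `|X w| <= c)%R.
Proof.
move=> mX; rewrite unlock => Xc.
have iX : P.-integrable setT (EFin \o X).
  apply/integrableP; split; first exact/measurable_EFinP.
  exact: le_lt_trans Xc (ltry _).
split=> //; rewrite -lee_fin fineK//.
by have /integrable_fin_num -> := integrable_norm iX.
Qed.

(** * Integrability and quasi-additivity under one law *)

Section one_law.
Variables (mu : probability G R) (M D : R).
Hypotheses (muM : first_moment_bound mu M) (muD : deviation_bound mu D).
Local Notation P := (iid_law mu).

Lemma integrable_defect n m : P.-integrable setT (EFin \o defect Q n m).
Proof.
by have [] := integrable_expectation_bound (measurable_defect n m) (muD n m).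
Qed.

Lemma Rintegral_defect_le n m : (\int[P]_w `|defect Q n m w| <= D)%R.
Proof.
by have [] := integrable_expectation_bound (measurable_defect n m) (muD n m).
Qed.

Lemma Rintegral_step_le : (\int[P]_w `|Q 1%N w| <= M)%R.
Proof.
by have [] := integrable_expectation_bound (adapted_measurable 1) muM.
Qed.

(** Moments are assumed for Q_1 and the defects; Q_{n+1} = Q_1 + Q_n o theta_1 + defect and
    stationarity propagate integrability. *)
Lemma integrable_cocycle n : P.-integrable setT (EFin \o Q n).
Proof.
elim: n => [|n IH].
  by case: adaptedQ => -> _; exact: (integrable0 P).
have iQ1 : P.-integrable setT (EFin \o Q 1%N).
  by have [] := integrable_expectation_bound (adapted_measurable 1) muM.
have iQn : P.-integrable setT (EFin \o (Q n \o path_shift 1)).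
  exact: (integrable_eq_law (@iid_law_shift mu 1) IH).
rewrite (_ : EFin \o Q n.+1 = ((EFin \o Q 1%N) \+
    (EFin \o (Q n \o path_shift 1))) \+ (EFin \o defect Q 1 n)).
  by apply: integrableD => //; [apply: integrableD|exact: integrable_defect].
by apply/funext => w /=; rewrite -!EFinD -defectE.
Qed.

(** By stationarity Q_m o theta_n and Q_m have the same mean, so the left side is the absolute value
    of the mean of a defect. *)
Lemma Rintegral_cocycle_quasi_additive n m :
  (`|\int[P]_w Q (n + m)%N w - \int[P]_w Q n w - \int[P]_w Q m w| <= D)%R.
Proof.
have iQ := integrable_cocycle; have idf := integrable_defect n m.
have ish : P.-integrable setT (EFin \o (fun w => Q m (path_shift n w))).
  exact: (integrable_eq_law (@iid_law_shift mu n) (iQ m)).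
apply: le_trans (Rintegral_defect_le n m).
apply: le_trans (le_normr_Rintegral measurableT idf).
rewrite -(Rintegral_eq_law (@iid_law_shift mu n) (iQ m)) -!RintegralB//.
by apply: (integrableB measurableT (iQ _) (iQ _)).
Qed.

End one_law.

(** * Replacing mu by nu one coordinate at a time *)

Section two_laws.
Variables (mu nu : probability G R) (M D e : R).
Hypotheses (muM : first_moment_bound mu M) (muD : deviation_bound mu D).
Hypotheses (nuM : first_moment_bound nu M) (nuD : deviation_bound nu D).
Hypotheses (e01 : (0 <= e <= 1)%R).
Hypothesis lo : forall A, measurable A -> (1 - e)%:E * mu A <= nu A.
Hypothesis hi : forall A, measurable A -> nu A <= (1 + e)%:E * mu A.
Local Notation P := (iid_law mu).

(** This is P_k: it starts at [iid_law mu] for k = 0, and its first k coordinates have the same law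
    as under [iid_law nu]. *)
Let mixed k : probability Omega R := iter k (path_step nu) P.

Let e0 : (0 <= e)%R. Proof. by case/andP: e01. Qed.

Let step_iid A : measurable A -> path_step mu P A = P A.
Proof. exact: (@iter_path_step_iid _ _ _ mu 1). Qed.

(** Both laws are k steps by nu, started from [path_step nu P] and from P, which agrees with
    [path_step mu P]. One coordinate differs, hence a single factor 1 + e. *)
Let mixedS_le k A : measurable A -> mixed k.+1 A <= (1 + e)%:E * mixed k A.
Proof.
move=> mA; rewrite -[leLHS]mul1e /mixed iterSr.
apply: iter_path_step_scaled mA => //; first by rewrite addr_ge0.
move=> B mB; rewrite -(step_iid mB).
have := @path_step_scaled _ _ _ nu mu P P 1 (1 + e) 1 1; rewrite !mulr1.
by apply=> // [|C mC]; [rewrite addr_ge0|rewrite mul1e hi].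
Qed.

Let mixedS_ge k A : measurable A -> (1 - e)%:E * mixed k A <= mixed k.+1 A.
Proof.
have [_ e1] := andP e01.
move=> mA; rewrite -[leRHS]mul1e /mixed iterSr.
apply: iter_path_step_scaled mA => //; first by rewrite subr_ge0.
move=> B mB; rewrite -(step_iid mB).
have := @path_step_scaled _ _ _ mu nu P P (1 - e) 1 1 1; rewrite !mulr1.
by apply=> // [|C mC]; [rewrite subr_ge0|rewrite mul1e lo].
Qed.

Let mixed_le k A : measurable A -> mixed k A <= ((1 + e) ^+ k)%:E * P A.
Proof.
move=> mA; elim: k => [|k IH]; first by rewrite expr0 mul1e.
apply: le_trans (mixedS_le k mA) _; rewrite exprS EFinM -muleA.
by rewrite lee_wpmul2l// lee_fin addr_ge0.
Qed.

Let pow_ge0 k : (0 <= (1 + e) ^+ k)%R.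
Proof. by rewrite exprn_ge0// addr_ge0. Qed.

Let integrable_mixed k f : P.-integrable setT f -> (mixed k).-integrable setT f.
Proof. by apply: integrable_scaled (pow_ge0 k) _ => A; exact: mixed_le. Qed.

Let mixed_integrable k n : (mixed k).-integrable setT (EFin \o Q n).
Proof. exact: integrable_mixed (integrable_cocycle muM muD n). Qed.

(** Q_m depends on the first m <= k coordinates, and k steps by nu give these the same law from any
    start. *)
Let mixed_prefix P' m k : (m <= k)%N ->
  (iter k (path_step nu) P').-integrable setT (EFin \o Q m) ->
  (\int[mixed k]_w Q m w = \int[iter k (path_step nu) P']_w Q m w)%R.
Proof.
move=> mk iQ; congr fine.
pose X : {mfun Omega >-> R} := HB.pack (Q m)
  (isMeasurableFun.Build _ _ _ _ _ (adapted_measurable m)).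
rewrite -(@integral_distribution _ _ _ _ _ (mixed k) X EFin)//; last first.
  exact: mixed_integrable.
rewrite -(@integral_distribution _ _ _ _ _ (iter k (path_step nu) P') X EFin)//.
apply: eq_measure_integral => A mA _; apply: iter_path_step_prefix.
apply: prefix_determinedW mk _; exact: adapted_prefix_determined.
Qed.

Let mixed_shift_integrable k f : P.-integrable setT (EFin \o f) ->
  (mixed k).-integrable setT (EFin \o (f \o path_shift k)).
Proof. by apply: integrable_eq_law => A; exact: iter_path_step_shift. Qed.

Let mixed_shift k f : P.-integrable setT (EFin \o f) ->
  (\int[mixed k]_w f (path_shift k w) = \int[P]_w f w)%R.
Proof. by apply: Rintegral_eq_law => A; exact: iter_path_step_shift. Qed.

(** Splitting Q_{k+1+m} at k, then Q_{1+m} o theta_k after one step, leaves these terms, whose means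
    may change when X_{k+1} is replaced. *)
Let residual k m w := (Q 1%N (path_shift k w) + defect Q 1 m (path_shift k w)
  + defect Q k (1 + m) w)%R.

Let integrable_residual k m :
  P.-integrable setT (EFin \o residual k m).
Proof.
have iD n p := integrable_defect muD n p.
have ish f : P.-integrable setT (EFin \o f) ->
    P.-integrable setT (EFin \o (f \o path_shift k)).
  by apply: integrable_eq_law => A; exact: iid_law_shift.
have iQ := integrable_cocycle muM muD 1.
have i12 : P.-integrable setT (EFin \o (fun w =>
    Q 1%N (path_shift k w) + defect Q 1 m (path_shift k w))%R).
  exact: (integrableD measurableT (ish _ iQ) (ish _ (iD 1%N m))).
exact: (integrableD measurableT i12 (iD k (1 + m)%N)).
Qed.

(** Under P_k the path shifted by k has law P, so the first two terms keep the bounds M and D; the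
    last defect also involves the replaced coordinates and pays (1 + e)^k. *)
Let Rintegral_residual_le k m :
  (\int[mixed k]_w `|residual k m w| <= M + D + (1 + e) ^+ k * D)%R.
Proof.
have norm_int P' f : P'.-integrable setT (EFin \o f) ->
  P'.-integrable setT (EFin \o (fun w : Omega => `|f w|%R)).
  exact: integrable_norm.
have iD n p := integrable_defect muD n p.
have iQ := integrable_cocycle muM muD 1.
have j1 : (mixed k).-integrable setT
    (EFin \o (fun w => `|Q 1%N (path_shift k w)|%R)).
  exact: (mixed_shift_integrable k (norm_int _ _ iQ)).
have j2 : (mixed k).-integrable setT
    (EFin \o (fun w => `|defect Q 1 m (path_shift k w)|%R)).
  exact: (mixed_shift_integrable k (norm_int _ _ (iD 1%N m))).
have j3 : (mixed k).-integrable setT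
    (EFin \o (fun w => `|defect Q k (1 + m) w|%R)).
  exact: integrable_mixed (norm_int _ _ (iD _ _)).
have j12 : (mixed k).-integrable setT (EFin \o (fun w =>
    `|Q 1%N (path_shift k w)| + `|defect Q 1 m (path_shift k w)|)%R).
  exact: (integrableD measurableT j1 j2).
apply: (@le_trans _ _ (\int[mixed k]_w (`|Q 1%N (path_shift k w)| +
  `|defect Q 1 m (path_shift k w)| + `|defect Q k (1 + m) w|))%R).
  apply: le_Rintegral => //.
  - exact: (norm_int _ _ (integrable_mixed k (integrable_residual k m))).
  - exact: (integrableD measurableT j12 j3).
  - move=> w _; apply: le_trans (ler_normD _ _) _; rewrite lerD2r.
    exact: ler_normD.
rewrite !RintegralD//; apply: lerD; first apply: lerD.
- rewrite (mixed_shift k (norm_int _ _ iQ)).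
  exact: Rintegral_step_le.
- rewrite (mixed_shift k (norm_int _ _ (iD 1%N m))).
  exact: Rintegral_defect_le.
- rewrite -[leLHS]mul1r.
  apply: (@le_trans _ _ ((1 + e) ^+ k * \int[P]_w `|defect Q k (1 + m) w|)%R).
    apply: le_Rintegral_scaled => //.
    + by move=> A mA; rewrite mul1e; exact: mixed_le.
    + exact: (norm_int _ _ (iD _ _)).
  by rewrite ler_wpM2l//; exact: Rintegral_defect_le.
Qed.

Let mixed_step k n : (k < n)%N ->
  (`|\int[mixed k.+1]_w Q n w - \int[mixed k]_w Q n w|
   <= e * (M + D + (1 + e) ^+ k * D))%R.
Proof.
move=> kn; have : n = (k + (1 + (n - k.+1)))%N by rewrite addnA addn1 subnKC.
move: (n - _)%N => m -> {kn}.
have iQ := integrable_cocycle muM muD.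
have QE w : (Q (k + (1 + m))%N w =
    Q k w + Q m (path_shift 1 (path_shift k w)) + residual k m w)%R.
  by rewrite /residual /defect; ring.
have shiftS w : path_shift 1 (path_shift k w) = path_shift k.+1 w :> Omega.
  by apply/funext => i; rewrite /path_shift addnS.
have iQ1 : P.-integrable setT (EFin \o (Q m \o path_shift 1)).
  exact: (integrable_eq_law (@iid_law_shift mu 1) (iQ m)).
have ir k' : (mixed k').-integrable setT (EFin \o residual k m).
  exact: integrable_mixed (integrable_residual k m).
have expand k' : (mixed k').-integrable setT
    (EFin \o (fun w => Q m (path_shift 1 (path_shift k w)))) ->
  (\int[mixed k']_w Q (k + (1 + m))%N w = \int[mixed k']_w Q k w +
   \int[mixed k']_w Q m (path_shift 1 (path_shift k w)) +
   \int[mixed k']_w residual k m w)%R.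
  move=> i2; have i1 := mixed_integrable k' k.
  have i12 := integrableD measurableT i1 i2.
  under eq_Rintegral do rewrite QE.
  rewrite (RintegralD measurableT i12 (ir k')).
  by rewrite (RintegralD measurableT i1 i2).
have iS : (mixed k.+1).-integrable setT
    (EFin \o (fun w => Q m (path_shift 1 (path_shift k w)))).
  under eq_fun do rewrite shiftS.
  exact: (mixed_shift_integrable k.+1 (iQ m)).
rewrite (expand k (mixed_shift_integrable k iQ1)) (expand k.+1 iS).
(* P_{k+1} is k steps by nu from [path_step nu P], so its first k coordinates have the same law as
   under P_k. *)
have -> : (\int[mixed k.+1]_w Q k w = \int[mixed k]_w Q k w)%R.
  rewrite (@mixed_prefix (path_step nu P) k k)//.
    by rewrite /mixed iterSr.
  by have := @mixed_integrable k.+1 k; rewrite /mixed iterSr.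
(* After k + 1 coordinates both laws are iid of law mu: for P_{k+1} directly, for P_k by shifting k
   times and using stationarity of P. *)
have -> : (\int[mixed k.+1]_w Q m (path_shift 1 (path_shift k w)) =
           \int[mixed k]_w Q m (path_shift 1 (path_shift k w)))%R.
  under eq_Rintegral do rewrite shiftS.
  rewrite (mixed_shift k.+1 (iQ m)) (mixed_shift k iQ1).
  by rewrite (Rintegral_eq_law (@iid_law_shift mu 1) (iQ m)).
rewrite opprD addrACA subrr add0r.
apply: le_trans (Rintegral_close e01 _ _ (ir k)) _.
- by move=> A; exact: mixedS_ge.
- by move=> A; exact: mixedS_le.
- by rewrite ler_wpM2l// Rintegral_residual_le.
Qed.

Lemma Rintegral_cocycle_close n :
  (`|\int[iid_law nu]_w Q n w - \int[P]_w Q n w| <=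
   n%:R * (e * (M + D + (1 + e) ^+ n * D)))%R.
Proof.
have D0 : (0 <= D)%R.
  apply: le_trans (Rintegral_defect_le muD 0 0); exact: Rintegral_ge0.
(* Q_n sees only the first n coordinates, so the start may be changed to [iid_law nu], which steps
   by nu preserve. *)
have nuQ : (\int[mixed n]_w Q n w = \int[iid_law nu]_w Q n w)%R.
  rewrite (@mixed_prefix (iid_law nu) n n)//.
    congr fine; apply: eq_measure_integral => A mA _.
    exact: iter_path_step_iid.
  apply: (@integrable_scaled _ _ _ _ (iid_law nu) 1%R) => //.
    by move=> A mA; rewrite mul1e [leLHS](iter_path_step_iid nu n mA).
  exact: integrable_cocycle nuM nuD n.
(* Telescoping from P_0 to P_k, with every power bounded by (1 + e)^n. *)
have : (forall k, (k <= n)%N -> `|\int[mixed k]_w Q n w - \int[P]_w Q n w| <=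
   k%:R * (e * (M + D + (1 + e) ^+ n * D)))%R.
  elim=> [_|k IH kn]; first by rewrite subrr normr0 mul0r.
  rewrite -natr1 mulrDl mul1r [leRHS]addrC.
  rewrite -(subrKA (\int[mixed k]_w Q n w)%R).
  apply: le_trans (ler_normD _ _) _; apply: lerD; last exact/IH/ltnW.
  apply: le_trans (mixed_step kn) _; rewrite ler_wpM2l// lerD2l ler_wpM2r//.
  by rewrite ler_weXn2l// ?lerDl// ltnW.
by move=> /(_ n (leqnn n)); rewrite nuQ.
Qed.

End two_laws.
End cocycle_expectation.

(** * Quasi-additive real sequences *)

Section quasi_additive_sequence.
Context (R : realType) (a : nat -> R) (D : R).
Hypothesis quasi_additive :
  forall n m, (`|a (n + m)%N - a n - a m| <= D)%R.

Lemma quasi_additive_muln n m :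
  (`|a (n * m.+1)%N - m.+1%:R * a n| <= m%:R * D)%R.
Proof.
elim: m => [|m IH]; first by rewrite muln1 mul1r subrr normr0 mul0r.
rewrite mulnS; have := quasi_additive n (n * m.+1)%N; move: IH.
rewrite -[m.+2%:R]natr1 -[m.+1%:R]natr1 !ler_norml.
by move=> /andP[? ?] /andP[? ?]; apply/andP; split; lra.
Qed.

(** Both ratios are compared through the value of a at n m, which is within (m - 1) D of m a_n and
    within (n - 1) D of n a_m. *)
Lemma quasi_additive_ratio n m : (0 < n)%N -> (0 < m)%N ->
  (a n / n%:R - D / n%:R <= a m / m%:R + D / m%:R)%R.
Proof.
move: n m => [//|n] [//|m] _ _.
have := quasi_additive_muln n.+1 m; have := quasi_additive_muln m.+1 n.
rewrite mulnC !ler_norml => /andP[_ h1] /andP[h2 _].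
have D0 : (0 <= D)%R by exact: le_trans (quasi_additive 0 0).
rewrite -mulrBl -mulrDl ler_pdivrMr ?ltr0n// mulrAC ler_pdivlMr ?ltr0n//.
rewrite -!natr1 in h1 h2 *; move: (ler0n R n) (ler0n R m) => n0 m0; nra.
Qed.

(** Every a_n / n - D / n lies below every a_m / m + D / m, so the supremum of the former is within
    D / n of each ratio. *)
Lemma quasi_additive_limit : exists l : R,
  (fun n => n%:R^-1 * a n)%R @ \oo --> l /\
  forall n, (0 < n)%N -> (`|a n / n%:R - l| <= D / n%:R)%R.
Proof.
pose S := [set (a n / n%:R - D / n%:R)%R | n in [set n | (0 < n)%N]].
have S0 : S !=set0 by exists (a 1%N / 1%:R - D / 1%:R)%R; exists 1%N.
have ubS m : (0 < m)%N -> ubound S (a m / m%:R + D / m%:R)%R.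
  by move=> m0 _ [n n0 <-]; exact: quasi_additive_ratio.
have supS : has_sup S.
  by split=> //; exists (a 1%N / 1%:R + D / 1%:R)%R; exact: ubS.
have close n : (0 < n)%N -> (`|a n / n%:R - sup S| <= D / n%:R)%R.
  move=> n0; have h1 : (a n / n%:R - D / n%:R <= sup S)%R.
    by apply: sup_upper_bound => //; exists n.
  have h2 : (sup S <= a n / n%:R + D / n%:R)%R.
    by apply: ge_sup => //; exact: ubS.
  by rewrite ler_norml; apply/andP; split; lra.
exists (sup S); split => //.
apply/cvgrPdist_le => eps eps0.
near=> n.
have n0 : (0 < n)%N by near: n; exists 1%N.
rewrite distrC mulrC; apply: le_trans (close n n0) _.
rewrite ler_pdivrMr ?ltr0n// mulrC -ler_pdivrMr//.
by near: n; exact: nbhs_infty_ger.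
Unshelve. all: by end_near. Qed.

End quasi_additive_sequence.

(** * From the density distance to inequalities between measures *)

Section density_distance.
Context d (G : measurableType d) (R : realType).

Lemma density_distance_ge0 (tmu mu : probability G R) :
  0 <= density_distance tmu mu.
Proof.
rewrite /density_distance; case: ifPn => // _.
have muT : 0 < mu setT by rewrite probability_setT lte01.
by rewrite le_max (ess_sup_gee muT)//; apply: nearW => x; exact: abse_ge0.
Qed.

(** Integrating |f - 1| <= e over A bounds |tmu A - mu A| by e mu A. *)
Lemma density_distance_close (tmu mu : probability G R) (e : R) :
  density_distance tmu mu <= e%:E -> forall A, measurable A ->
  (1 - e)%:E * mu A <= tmu A /\ tmu A <= (1 + e)%:E * mu A.
Proof.
move=> de; have e0 : (0 <= e)%R.
  by rewrite -lee_fin; exact: le_trans (density_distance_ge0 _ _) de.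
move: de; rewrite /density_distance; case: ifPn; last by rewrite leye_eq.
move=> /asboolP[tmu_mu _]; rewrite ge_max => /andP[/ess_supP fe _] A mA.
set f := Radon_Nikodym _ _ in fe.
have intf : mu.-integrable setT f by exact: Radon_Nikodym_integrable.
have tmuE : tmu A = \int[mu]_(x in A) f x.
  exact: (@Radon_Nikodym_integral _ _ _ (charge_of_finite_measure tmu)).
have intA : mu.-integrable A f by exact: integrableS intf.
have int1 : mu.-integrable A (cst 1%:E) by exact: finite_measure_integrable_cst.
have : `|tmu A - mu A| <= e%:E * mu A.
  have -> : tmu A - mu A = \int[mu]_(x in A) (f x - 1).
    by rewrite tmuE integralB// integral_cst// mul1e.
  have intB := integrableB mA intA int1.
  apply: le_trans (le_abse_integral _ mA (measurable_int _ intB)) _.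
  rewrite -integral_cst//; apply: ae_ge0_le_integral => //.
  - by apply: measurableT_comp => //; exact: measurable_int intB.
  - by apply: filterS fe => x fx _.
rewrite -(fineK (fin_num_measure tmu A mA)) -(fineK (fin_num_measure mu A mA)).
rewrite -EFinB -!EFinM abse_EFin !lee_fin ler_norml => /andP[? ?].
by split; lra.
Qed.

End density_distance.

(** * Comparing the rates of escape of two laws *)

Section rate_of_escape_bounds.
Context d (G : measurableType d) (R : realType) (Q : nat -> path_space G -> R).
Variables (M D : R).
Hypothesis adaptedQ : defective_adapted_cocycle Q.
Implicit Types mu nu : probability G R.

(** The means are quasi-additive, so the limit is real and known up to D / n at time n; rates can be
    compared at a finite time. *)
Lemma rate_of_escape_close mu :
  first_moment_bound Q mu M -> deviation_bound Q mu D ->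
  exists2 l : R, rate_of_escape Q mu = l%:E & forall n, (0 < n)%N ->
    (`|(\int[iid_law mu]_w Q n w) / n%:R - l| <= D / n%:R)%R.
Proof.
move=> muM muD.
have [l [cvl close]] := quasi_additive_limit
  (Rintegral_cocycle_quasi_additive adaptedQ muM muD).
exists l => //; apply: cvg_lim => //.
rewrite (_ : (fun n => _) =
    EFin \o (fun n => n%:R^-1 * \int[iid_law mu]_w Q n w)%R).
  by apply: cvg_EFin => //; exact: nearW.
apply/funext => n /=; rewrite EFinM unlock fineK//.
exact: integrable_fin_num (integrable_cocycle adaptedQ muM muD n).
Qed.

(** For e <= 1 the two errors D / n give 4 D e and the means give (M + D + exp(1) D) e; for e > 1,
    time 1 gives the bound 2 M + 2 D. The constant covers both cases. *)
Lemma rate_of_escape_lipschitz mu nu (e : R) : (0 < e)%R ->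
  first_moment_bound Q mu M -> deviation_bound Q mu D ->
  first_moment_bound Q nu M -> deviation_bound Q nu D ->
  (forall A, measurable A -> (1 - e)%:E * mu A <= nu A /\
    nu A <= (1 + e)%:E * mu A) ->
  `|rate_of_escape Q mu - rate_of_escape Q nu| <=
    ((2 * M + 5 * D + expR 1 * D) * e)%:E.
Proof.
move=> e0 muM muD nuM nuD munu.
have D0 : (0 <= D)%R.
  apply: le_trans (Rintegral_defect_le adaptedQ muD 0 0); exact: Rintegral_ge0.
have M0 : (0 <= M)%R.
  apply: le_trans (Rintegral_step_le adaptedQ muM); exact: Rintegral_ge0.
have [l -> ll] := rate_of_escape_close muM muD.
have [l' -> ll'] := rate_of_escape_close nuM nuD.
rewrite -EFinB abse_EFin lee_fin.
have X0 : (0 <= expR 1 * D :> R)%R by rewrite mulr_ge0// expR_ge0.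
have [e1|e1] := leP e 1%R; last first.
  have bound mu' : first_moment_bound Q mu' M -> deviation_bound Q mu' D ->
      (`|\int[iid_law mu']_w Q 1%N w| <= M)%R.
    move=> h h'; apply: le_trans (Rintegral_step_le adaptedQ h).
    apply: le_normr_Rintegral => //; exact: integrable_cocycle h h' 1%N.
  have := bound _ muM muD; have := bound _ nuM nuD.
  have := ll 1%N isT; have := ll' 1%N isT; rewrite !divr1 !ler_norml.
  move=> /andP[? ?] /andP[? ?] /andP[? ?] /andP[? ?].
  by apply/andP; split; nra.
(* Then n e <= 1, so (1 + e)^n <= exp(n e) <= exp(1), while 2 n >= n + 1 > 1 / e gives 1 / n <= 2
   e. *)
pose n := Num.truncn e^-1.
have ei : (1 <= e^-1)%R by rewrite invf_ge1.
have n0 : (0 < n)%N by rewrite truncn_gt0.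
have nR0 : (0 < n%:R :> R)%R by rewrite ltr0n.
have /andP[nle nlt] := truncn_itv (ltW (lt_le_trans ltr01 ei)).
have ne1 : (n%:R * e <= 1)%R.
  by rewrite -ler_pdivlMr// mul1r.
have ne2 : (n%:R^-1 <= 2 * e)%R.
  rewrite -div1r ler_pdivrMr//.
  have : (1 < n.+1%:R * e)%R by rewrite -ltr_pdivrMr// mul1r.
  rewrite -natr1; have : (1 <= n%:R :> R)%R by rewrite ler1n.
  nra.
have pow : ((1 + e) ^+ n <= expR 1)%R.
  apply: (@le_trans _ _ (expR (n%:R * e))); last by rewrite ler_expR.
  rewrite expRM_natl lerXn2r ?nnegrE ?expR_ge0 ?expR_ge1Dx//.
  by rewrite addr_ge0// ltW.
have e01 : (0 <= e <= 1)%R by rewrite ltW.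
have := Rintegral_cocycle_close adaptedQ muM muD nuM nuD e01
  (fun A mA => (munu A mA).1) (fun A mA => (munu A mA).2) n.
have := ll n n0; have := ll' n n0.
set a := (\int[iid_law mu]_w _)%R; set a' := (\int[iid_law nu]_w _)%R.
move=> h' h ha.
have {}ha : (`|a' / n%:R - a / n%:R| <= e * (M + D + expR 1 * D))%R.
  rewrite -mulrBl normrM [X in (_ * X)%R]ger0_norm ?invr_ge0 ?ler0n//.
  rewrite ler_pdivrMr// mulrC; apply: le_trans ha _.
  by rewrite ler_wpM2l ?ler0n// ler_wpM2l ?(ltW e0)// lerD2l ler_wpM2r.
have Dn : (D / n%:R <= D * (2 * e))%R by rewrite ler_wpM2l.
move: h h' ha; rewrite !ler_norml => /andP[? ?] /andP[? ?] /andP[? ?].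
have Me : (0 <= M * e)%R by rewrite mulr_ge0// ltW.
by apply/andP; split; nra.
Qed.

End rate_of_escape_bounds.

(** * A Lipschitz constant for the whole family of laws *)

Theorem theorem5p2 (d : measure_display) (G : measurableType d) (R : realType)
    (Q : nat -> path_space G -> R) (B : set (probability G R)) :
  defective_adapted_cocycle Q ->
  convex_probabilities B ->
  uniform_first_moment Q B ->
  uniform_deviation_inequality Q B ->
  exists C : R, forall mu0 mu1 : probability G R, B mu0 -> B mu1 ->
    `|rate_of_escape Q mu1 - rate_of_escape Q mu0| <=
      C%:E * density_distance mu0 mu1.
Proof.
move=> adaptedQ _ momentQ deviationQ.
have real_bound (x : \bar R) : x < +oo -> exists r : R, x <= r%:E.
  by case: x => [r _||_]; [exists r|rewrite ltxx|exists 0%R; rewrite leNye].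
have [M supM] := real_bound _ momentQ.
have [D supD] := real_bound _ deviationQ.
have muM mu : B mu -> first_moment_bound Q mu M.
  by move=> Bmu; apply: le_trans supM; apply: ereal_sup_ubound; exists mu.
have muD mu : B mu -> deviation_bound Q mu D.
  move=> Bmu n m; apply: le_trans supD.
  apply: (@le_trans _ _ (ereal_sup (range (fun nm : nat * nat =>
      'E_(iid_law mu)[fun w => `|defect Q nm.1 nm.2 w|%R])))).
    by apply: ereal_sup_ubound; exists (n, m).
  by apply: ereal_sup_ubound; exists mu => //.
(* The absolute value and the added 1 make C positive, for the infinite distance and for the
   division by C. *)
pose C : R := (`|2 * M + 5 * D + expR 1 * D| + 1)%R.
have C0 : (0 < C)%R by rewrite ltr_wpDl.
exists C => mu0 mu1 Bmu0 Bmu1.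
(* The reference law of this distance is mu1, so mu1 takes the role of mu and mu0 that of nu. *)
have := @density_distance_close _ _ _ mu0 mu1.
have := density_distance_ge0 mu0 mu1.
case: (density_distance mu0 mu1) => [r|_ _|//]; last first.
  by rewrite gt0_muley ?lte_fin// leey.
(* The comparison requires e > 0 but r may be 0, so it is applied to r + eps / C for every eps >
   0. *)
rewrite lee_fin => r0 close; apply/lee_addgt0Pr => _/posnumP[eps].
have e0 : (0 < r + eps%:num / C)%R by rewrite ltr_wpDl// divr_gt0.
apply: le_trans (rate_of_escape_lipschitz adaptedQ e0 (muM _ Bmu1)
  (muD _ Bmu1) (muM _ Bmu0) (muD _ Bmu0) (close _ _)) _.
  by rewrite lee_fin lerDl divr_ge0// (ltW C0).
rewrite -EFinM -EFinD lee_fin.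
have -> : (C * r + eps%:num = C * (r + eps%:num / C))%R.
  by rewrite mulrDr mulrCA divff ?mulr1 ?gt_eqF.
rewrite ler_wpM2r ?(ltW e0)//.
by rewrite (le_trans (ler_norm _))// lerDl.
Qed.
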